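(* Let $\mathcal{P}\subseteq\mathcal{G}$ be a graph problem and let $\mathfrak{C}$ be a dynamic core that solves $\mathcal{P}$. Given a graph $G\in\mathcal{G}$ and a rooted tree decomposition $\mathcal{D}=(T,q,\mathcal{X})$ of $G$, one can decide whether $G\in\mathcal{P}$ in time $\mathcal{O}\big(\sum_{t\in V(T)}|\mathrm{Process}_{\mathfrak{C},G,\mathcal{D}}(t)|+\tau(\mathfrak{C},G,\mathcal{D})\big)$.
   Context: $\mathcal{G}$ is the set of simple undirected graphs whose vertex set is a finite subset of $\mathbb{N}$; a graph problem is a subset of $\mathcal{G}$. A rooted tree decomposition of $G$ is $(T,q,\mathcal{X})$ with $T$ a tree rooted at $q$, bags $X_t\subseteq V(G)$ covering $V(G)$, every edge in some bag, and $X_x\cap X_y\subseteq X_z$ whenever $z$ is on the $x$–$y$ path; by convention the root bag is empty, each node $t$ has $\delta(t)\le 2$ children and at most one vertex of $X_t$ not in a child bag. A dynamic core is an algorithm $\mathfrak{C}$ that, given $G\in\mathcal{G}$ and a rooted tree decomposition $\mathcal{D}$ of $G$, produces a finite set $\mathrm{Accept}_{\mathfrak{C},G,\mathcal{D}}$ of binary strings and for each node $t$ with children $t_1,\ldots,t_{\delta(t)}$ a finite set $\mathrm{Process}_{\mathfrak{C},G,\mathcal{D}}(t)$ of $(\delta(t)+1)$-tuples of binary strings; $\tau(\mathfrak{C},G,\mathcal{D})$ is the total time to produce all this data. A $(\mathfrak{C},G,\mathcal{D})$-witness is $\alpha:V(T)\to\{0,1\}^*$ with $(\alpha(t),\alpha(t_1),\ldots,\alpha(t_{\delta(t)}))\in\mathrm{Process}_{\mathfrak{C},G,\mathcal{D}}(t)$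 for every node $t$ and $\alpha(q)\in\mathrm{Accept}_{\mathfrak{C},G,\mathcal{D}}$. $\mathfrak{C}$ solves $\mathcal{P}$ if for every $G\in\mathcal{G}$ and every rooted tree decomposition $\mathcal{D}$ of $G$: $G\in\mathcal{P}$ iff a $(\mathfrak{C},G,\mathcal{D})$-witness exists. *)

(* Defs.v *)
From mathcomp Require Import all_boot.
From mathcomp Require Import finmap.

Set Implicit Arguments.
Unset Strict Implicit.
Unset Printing Implicit Defensive.

Local Open Scope fset_scope.

(* Edges are two-element subsets of the vertex set, so that equality of graphs
   is equality of their vertex sets and edge sets. *)
Record graph := Graph {
  gV : {fset nat};
  gE : {fset {fset nat}};
  _ : all (fun e : {fset nat} => (e `<=` gV) && (#|` e| == 2)) gE
}.

Definition graph_problem := graph -> Prop.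

Definition simple_path (T : eqType) (e : rel T) (x : T) (p : seq T) (y : T) :=
  [&& path e x p, uniq (x :: p) & last x p == y].

Definition is_tree (T : finType) (e : rel T) : Prop :=
  [/\ symmetric e, irreflexive e, (forall x y, connect e x y)
    & forall c : seq T, 2 < size c -> ~ ucycle e c].

(* [s] is a child of [t] in the tree rooted at [q]: [t] is the vertex preceding
   [s] on the path from [q] to [s]. *)
Definition is_child (m : nat) (e : rel 'I_m) (q t s : 'I_m) : bool :=
  [exists n : 'I_m, [exists p : n.-tuple 'I_m,
    simple_path e q (rcons p s) s && (last q p == t)]].

Definition tree_children (m : nat) (e : rel 'I_m) (q t : 'I_m) : seq 'I_m :=
  [seq s <- enum 'I_m | is_child e q t s].

(* The nodes of the tree are numbered 0, ..., m - 1, since the decomposition is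
   the input of an algorithm; the children of a node are ordered by number. *)
Record tree_decomposition (G : graph) := TreeDecomposition {
  nnodes : nat;
  tadj : rel 'I_nnodes;
  troot : 'I_nnodes;
  bag : 'I_nnodes -> {fset nat};
  td_tree : is_tree tadj;
  td_bag_sub : forall t, bag t `<=` gV G;
  td_cover : forall v, v \in gV G -> exists t, v \in bag t;
  td_edge : forall e, e \in gE G -> exists t, e `<=` bag t;
  td_path : forall x y z p,
    simple_path tadj x p y -> z \in x :: p -> bag x `&` bag y `<=` bag z;
  td_root_bag : bag troot = fset0;
  td_degree : forall t, size (tree_children tadj troot t) <= 2;
  td_introduce : forall t, #|` [fset v in bag t |
    ~~ has (fun s => v \in bag s) (tree_children tadj troot t)]| <= 1
}.

Definition node (G : graph) (D : tree_decomposition G) := 'I_(nnodes D).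

Definition children (G : graph) (D : tree_decomposition G) (t : node D) :
  seq (node D) := tree_children (@tadj G D) (troot D) t.

(* Random access machine with uniform cost: registers and memory cells hold
   natural numbers, the input is a read-only random-access array and the output
   a write-only tape. There is no multiplication, so that numbers grow by at
   most one bit per step. *)
Inductive prog :=
  | Const of nat & nat           (* R[x] := k *)
  | Add of nat & nat & nat       (* R[x] := R[y] + R[z] *)
  | Sub of nat & nat & nat       (* R[x] := R[y] - R[z], truncated *)
  | Read of nat & nat            (* R[x] := Input[R[y]] *)
  | Fetch of nat & nat            (* R[x] := Mem[R[y]] *)
  | Store of nat & nat           (* Mem[R[x]] := R[y] *)
  | Write of nat                 (* append R[x] to the output *)
  | Seq of prog & prog
  | If of nat & prog & prog      (* first branch iff R[x] is nonzero *)
  | While of nat & prog.         (* loop as long as R[x] is nonzero *)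

Record state := State {
  regs : nat -> nat;
  mem : nat -> nat;
  out : seq nat
}.

Definition update (f : nat -> nat) (x v : nat) : nat -> nat :=
  fun y => if y == x then v else f y.

Definition set_reg (s : state) (x v : nat) :=
  State (update (regs s) x v) (mem s) (out s).

Definition init_state := State (fun=> 0) (fun=> 0) [::].

(* [exec inp c s n s']: on input array [inp], [c] started in [s] halts in [s']
   after [n] steps; each basic instruction and each test is one step. *)
Inductive exec (inp : nat -> nat) : prog -> state -> nat -> state -> Prop :=
  | ExecConst x k s : exec inp (Const x k) s 1 (set_reg s x k)
  | ExecAdd x y z s :
      exec inp (Add x y z) s 1 (set_reg s x (regs s y + regs s z))
  | ExecSub x y z s :
      exec inp (Sub x y z) s 1 (set_reg s x (regs s y - regs s z))
  | ExecRead x y s : exec inp (Read x y) s 1 (set_reg s x (inp (regs s y)))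
  | ExecFetch x y s : exec inp (Fetch x y) s 1 (set_reg s x (mem s (regs s y)))
  | ExecStore x y s :
      exec inp (Store x y) s 1
        (State (regs s) (update (mem s) (regs s x) (regs s y)) (out s))
  | ExecWrite x s :
      exec inp (Write x) s 1 (State (regs s) (mem s) (rcons (out s) (regs s x)))
  | ExecSeq c1 c2 s s1 s2 n1 n2 :
      exec inp c1 s n1 s1 -> exec inp c2 s1 n2 s2 ->
      exec inp (Seq c1 c2) s (n1 + n2) s2
  | ExecIfT x c1 c2 s s1 n :
      regs s x != 0 -> exec inp c1 s n s1 -> exec inp (If x c1 c2) s n.+1 s1
  | ExecIfF x c1 c2 s s1 n :
      regs s x = 0 -> exec inp c2 s n s1 -> exec inp (If x c1 c2) s n.+1 s1
  | ExecWhileT x c s s1 s2 n1 n2 :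
      regs s x != 0 -> exec inp c s n1 s1 -> exec inp (While x c) s1 n2 s2 ->
      exec inp (While x c) s (n1 + n2).+1 s2
  | ExecWhileF x c s :
      regs s x = 0 -> exec inp (While x c) s 1 s.

(* Running times and outputs are thus functions of the program and the input. *)
Lemma exec_det inp c s n1 s1 n2 s2 :
  exec inp c s n1 s1 -> exec inp c s n2 s2 -> n1 = n2 /\ s1 = s2.
Proof.
move=> H; elim: H n2 s2 => {c s n1 s1};
  try by move=> *; match goal with H : exec _ _ _ _ _ |- _ => inversion H end.
- move=> c1 c2 s s1 s2 n1 n2 _ IH1 _ IH2 n3 s3 H.
  inversion H as [| | | | | | |? ? ? ? ? ? ? E1 E2| | | |]; subst.
  by case: (IH1 _ _ E1) E2 => -> <- /IH2[-> ->].
- move=> x c1 c2 s s1 n nz _ IH n2 s2 H.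
  inversion H as [| | | | | | | |? ? ? ? ? ? ? E|? ? ? ? ? ? z| |]; subst.
    by case: (IH _ _ E) => -> ->.
  by rewrite z in nz.
- move=> x c1 c2 s s1 n z _ IH n2 s2 H.
  inversion H as [| | | | | | | |? ? ? ? ? ? nz|? ? ? ? ? ? ? E| |]; subst.
    by rewrite z in nz.
  by case: (IH _ _ E) => -> ->.
- move=> x c s s1 s2 n1 n2 nz _ IH1 _ IH2 n3 s3 H.
  inversion H as [| | | | | | | | | |? ? ? ? ? ? ? ? E1 E2|? ? ? z]; subst.
    by case: (IH1 _ _ E1) E2 => -> <- /IH2[-> ->].
  by rewrite z in nz.
- move=> x c s z n2 s2 H.
  inversion H as [| | | | | | | | | |? ? ? ? ? ? ? nz|]; subst=> //.
  by rewrite z in nz.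
Qed.

Definition runs (c : prog) (input : seq nat) (n : nat) (output : seq nat) :=
  exists2 s, exec (nth 0 input) c init_state n s & out s = output.

(* Input array: the rooted tree (number of nodes, root, and for each node its
   number of children followed by two cells for the children, padded with 0),
   then the bag of each node, then the adjacency lists of the graph. Bags and
   neighbourhoods are preceded by their sizes. *)
Definition enc_list (s : seq nat) : seq nat := size s :: s.

Definition neighbours (G : graph) (v : nat) : seq nat :=
  [seq w <- sort leq (gV G) | [fset v; w] \in gE G].

Definition enc_graph (G : graph) : seq nat :=
  #|` gV G| ::
    flatten [seq v :: enc_list (neighbours G v) | v <- sort leq (gV G)].

Definition enc_children (G : graph) (D : tree_decomposition G) (t : node D) :
  seq nat :=
  let cs := [seq val s | s <- children t] in
  [:: size cs; nth 0 cs 0; nth 0 cs 1].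

Definition encode (G : graph) (D : tree_decomposition G) : seq nat :=
  [:: nnodes D; val (troot D)]
  ++ flatten [seq enc_children t | t <- enum (node D)]
  ++ flatten [seq enc_list (sort leq (bag t)) | t <- enum (node D)]
  ++ enc_graph G.

Definition bitstring := seq bool.

(* Output alphabet: 0 and 1 are bits, 2 ends a string, 3 ends a set. *)
Definition enc_string (s : bitstring) : seq nat :=
  rcons [seq nat_of_bool b | b <- s] 2.

Definition enc_tuples (l : seq (seq bitstring)) : seq nat :=
  rcons (flatten [seq flatten [seq enc_string s | s <- u] | u <- l]) 3.

Definition process_set (G : graph) (D : tree_decomposition G) (t : node D) :=
  {fset (size (children t)).+1.-tuple bitstring}.

(* The sets are written in an arbitrary listing of their elements, the nodes
   being taken in the order of their numbers. *)
Definition core_output (G : graph) (D : tree_decomposition G)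
    (A : {fset bitstring}) (Q : forall t : node D, process_set t)
    (o : seq nat) : Prop :=
  exists (la : seq bitstring)
         (lq : forall t : node D, seq ((size (children t)).+1.-tuple bitstring)),
  [/\ la =i A, (forall t, lq t =i Q t)
    & o = enc_tuples [seq [:: s] | s <- la]
          ++ flatten [seq enc_tuples [seq tval u | u <- lq t]
                     | t <- enum (node D)]].

Record dynamic_core := DynamicCore {
  core_prog : prog;
  Accept : forall (G : graph) (D : tree_decomposition G), {fset bitstring};
  Process : forall (G : graph) (D : tree_decomposition G) (t : node D),
    process_set t;
  core_time : forall (G : graph) (D : tree_decomposition G), nat;
  core_spec : forall (G : graph) (D : tree_decomposition G),
    exists2 o, runs core_prog (encode D) (core_time D) o
             & core_output (Accept D) (Process (D := D)) o
}.

Definition witness (C : dynamic_core) (G : graph) (D : tree_decomposition G)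
    (a : node D -> bitstring) : Prop :=
  (forall t : node D,
     cons_tuple (a t) (map_tuple a (in_tuple (children t))) \in Process C t)
  /\ a (troot D) \in Accept C D.

Definition solves (C : dynamic_core) (P : graph_problem) : Prop :=
  forall (G : graph) (D : tree_decomposition G),
    P G <-> exists a : node D -> bitstring, witness C a.

(* Main.v *)
Require Import Defs.
From mathcomp Require Import all_boot.
From mathcomp Require Import finmap.
From mathcomp Require Import zify.

(* Run the core with its output redirected to memory. The output has length at
   most the running time of the core, and at least the number of nodes, so it
   remains to decide in time linear in that length whether a witness exists.
   Call a string feasible at [t] if it is the first entry of a tuple of
   Process(t) whose other entries are feasible at the respective children of
   [t]; a witness exists iff some accepted string is feasible at the root.
   Feasibility is computed bottom-up, in reverse breadth-first order. The set of
   feasible strings is a table addressed by numbers: starting from [N + t], with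
   [N] the number of nodes, and appending the bits of [s] in binary gives
   distinct numbers for distinct pairs [(t, s)], each computed in time
   [O(|s|)]. *)

Set Implicit Arguments.
Unset Strict Implicit.
Unset Printing Implicit Defensive.

(** * A structured language over the random access machine *)

(* [Core] is the memory of the simulated core and [Out] its output; [Start]
   holds the position in [Out] of the section of each node, [Queue] the nodes in
   breadth-first order, and [Mark] is nonzero at [push_bits (N + t) s] when [s]
   is feasible at node [t], where [N] is the number of nodes. *)
Inductive region := Core | Out | Start | Queue | Mark.

Definition rcode (r : region) : nat :=
  match r with Core => 0 | Out => 1 | Start => 2 | Queue => 3 | Mark => 4 end.

Inductive var :=
  | Ptr | Val | Adr | Ok | Idx | Nod | Hd | Tl | Res | CoreReg of nat.

Definition vcode (x : var) : nat :=
  match x with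
  | Ptr => 0 | Val => 1 | Adr => 2 | Ok => 3 | Idx => 4 | Nod => 5 | Hd => 6
  | Tl => 7 | Res => 8 | CoreReg x => x.+4.+4.+1
  end.

Lemma rcode_inj : injective rcode.
Proof. by move=> [] []. Qed.

Inductive expr :=
  | Cst of nat
  | Var of var
  | Plus of expr & expr
  | Minus of expr & expr
  | Inp of expr
  | At of region & expr.

Inductive cmd :=
  | Assign of var & expr
  | Put of region & expr & expr
  | Print of expr
  | Then of cmd & cmd
  | Cond of expr & cmd & cmd
  | Loop of expr & cmd.

(** [clock] counts assignments, memory writes, prints and tests. Evaluating an expression is free at
    this level: its compiled cost depends only on its syntax and is charged by a constant factor
    later. *)
Record hstate := HState {
  hr : var -> nat;
  hm : region -> nat -> nat;
  ho : seq nat;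
  clock : nat
}.

Definition set_var s x v :=
  HState (fun y => if vcode y == vcode x then v else hr s y)
         (hm s) (ho s) (clock s).+1.

Definition set_mem s r a v :=
  HState (hr s) (fun r' => if rcode r' == rcode r then update (hm s r) a v
                           else hm s r') (ho s) (clock s).+1.

Definition print s v := HState (hr s) (hm s) (rcons (ho s) v) (clock s).+1.

Definition tick s := HState (hr s) (hm s) (ho s) (clock s).+1.

Fixpoint ev (inp : nat -> nat) (s : hstate) (e : expr) : nat :=
  match e with
  | Cst k => k
  | Var x => hr s x
  | Plus a b => ev inp s a + ev inp s b
  | Minus a b => ev inp s a - ev inp s b
  | Inp a => inp (ev inp s a)
  | At r a => hm s r (ev inp s a)
  end.

Inductive hexec (inp : nat -> nat) : cmd -> hstate -> hstate -> Prop :=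
  | HAssign x e s : hexec inp (Assign x e) s (set_var s x (ev inp s e))
  | HPut r a e s :
      hexec inp (Put r a e) s (set_mem s r (ev inp s a) (ev inp s e))
  | HPrint e s : hexec inp (Print e) s (print s (ev inp s e))
  | HThen c1 c2 s s1 s2 :
      hexec inp c1 s s1 -> hexec inp c2 s1 s2 -> hexec inp (Then c1 c2) s s2
  | HCondT e c1 c2 s s1 :
      ev inp s e != 0 -> hexec inp c1 (tick s) s1 ->
      hexec inp (Cond e c1 c2) s s1
  | HCondF e c1 c2 s s1 :
      ev inp s e = 0 -> hexec inp c2 (tick s) s1 ->
      hexec inp (Cond e c1 c2) s s1
  | HLoopT e c s s1 s2 :
      ev inp s e != 0 -> hexec inp c (tick s) s1 ->
      hexec inp (Loop e c) s1 s2 -> hexec inp (Loop e c) s s2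
  | HLoopF e c s : ev inp s e = 0 -> hexec inp (Loop e c) s (tick s).

(** * Compilation *)

(* Even registers hold the variables, odd registers are scratch; cell [a] of
   region [r] is the machine cell [8 * a + rcode r]. *)
Definition reg (x : var) := (vcode x).*2.
Definition tmp (d : nat) := d.*2.+1.

(** Three doublings stand for the multiplication by 8, which the machine does not offer. *)
Definition caddr (r : region) (d : nat) : prog :=
  let dbl := Add (tmp d) (tmp d) (tmp d) in
  Seq dbl (Seq dbl (Seq dbl
    (Seq (Const (tmp d.+1) (rcode r)) (Add (tmp d) (tmp d) (tmp d.+1))))).

(** Stack discipline: the value ends up in [tmp d] and the scratch registers below [d] are
    untouched, so a first operand survives the evaluation of the second. Copying a register is
    adding zero to it. *)
Fixpoint cexpr (e : expr) (d : nat) : prog :=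
  match e with
  | Cst k => Const (tmp d) k
  | Var x => Seq (Const (tmp d) 0) (Add (tmp d) (reg x) (tmp d))
  | Plus a b =>
      Seq (cexpr a d) (Seq (cexpr b d.+1) (Add (tmp d) (tmp d) (tmp d.+1)))
  | Minus a b =>
      Seq (cexpr a d) (Seq (cexpr b d.+1) (Defs.Sub (tmp d) (tmp d) (tmp d.+1)))
  | Inp a => Seq (cexpr a d) (Read (tmp d) (tmp d))
  | At r a => Seq (cexpr a d) (Seq (caddr r d) (Fetch (tmp d) (tmp d)))
  end.

Fixpoint compile (c : cmd) : prog :=
  match c with
  | Assign x e =>
      Seq (cexpr e 0) (Seq (Const (tmp 1) 0) (Add (reg x) (tmp 0) (tmp 1)))
  | Put r a e =>
      Seq (cexpr a 0)
        (Seq (caddr r 0) (Seq (cexpr e 1) (Store (tmp 0) (tmp 1))))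
  | Print e => Seq (cexpr e 0) (Write (tmp 0))
  | Then c1 c2 => Seq (compile c1) (compile c2)
  | Cond e c1 c2 => Seq (cexpr e 0) (If (tmp 0) (compile c1) (compile c2))
  | Loop e c =>
      Seq (cexpr e 0) (While (tmp 0) (Seq (compile c) (cexpr e 0)))
  end.

Fixpoint ecost (e : expr) : nat :=
  match e with
  | Cst _ => 1
  | Var _ => 2
  | Plus a b | Minus a b => (ecost a + ecost b).+1
  | Inp a => (ecost a).+1
  | At _ a => ecost a + 6
  end.

(** Not a running time, but a bound on the number of machine steps per tick of [clock]; it is
    therefore finite for loops as well. *)
Fixpoint cost (c : cmd) : nat :=
  match c with
  | Assign _ e => ecost e + 2
  | Put _ a e => ecost a + ecost e + 6
  | Print e => (ecost e).+1
  | Then c1 c2 => cost c1 + cost c2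
  | Cond e c1 c2 => (ecost e + cost c1 + cost c2).+1
  | Loop e c => (ecost e + cost c).+1
  end.

Definition represents (u : state) (h : hstate) : Prop :=
  [/\ forall x, regs u (reg x) = hr h x,
      forall r a, Defs.mem u (a * 8 + rcode r) = hm h r a
    & out u = ho h].

Lemma updateE f x v : update f x v x = v.
Proof. by rewrite /update eqxx. Qed.

Lemma updateN f x v y : y <> x -> update f x v y = f y.
Proof. by rewrite /update; case: eqP. Qed.

Lemma represents_tmp u h d v :
  represents u h -> represents (set_reg u (tmp d) v) h.
Proof.
case=> Hr Hm Ho; split=> // x /=.
by rewrite updateN // /reg /tmp; lia.
Qed.

Lemma caddr_correct inp r d u h :
  represents u h ->
  exists u', [/\ exec inp (caddr r d) u 5 u', represents u' h,
    regs u' (tmp d) = regs u (tmp d) * 8 + rcode r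
  & forall d', d' < d -> regs u' (tmp d') = regs u (tmp d')].
Proof.
move=> Hu.
eexists; split.
- rewrite /caddr -[5]/(1 + (1 + (1 + (1 + 1)))).
  by do 4 (apply: ExecSeq; first by constructor); constructor.
- by do 5 apply: represents_tmp.
- have ne : tmp d <> tmp d.+1 by rewrite /tmp; lia.
  by rewrite /= !(updateE, updateN _ _ ne); lia.
- by move=> d' lt; rewrite /= !updateN //; rewrite /tmp; lia.
Qed.

Lemma cexpr_correct inp e d u h :
  represents u h ->
  exists u', [/\ exec inp (cexpr e d) u (ecost e) u', represents u' h,
    regs u' (tmp d) = ev inp h e
  & forall d', d' < d -> regs u' (tmp d') = regs u (tmp d')].
Proof.
have bin (a b : expr) (o : prog) (f : nat -> nat -> nat) :
    (forall d u h, represents u h ->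
      exists u', [/\ exec inp (cexpr a d) u (ecost a) u', represents u' h,
        regs u' (tmp d) = ev inp h a
      & forall d', d' < d -> regs u' (tmp d') = regs u (tmp d')]) ->
    (forall d u h, represents u h ->
      exists u', [/\ exec inp (cexpr b d) u (ecost b) u', represents u' h,
        regs u' (tmp d) = ev inp h b
      & forall d', d' < d -> regs u' (tmp d') = regs u (tmp d')]) ->
    forall d u h, represents u h ->
    (forall s, exec inp o s 1
       (set_reg s (tmp d) (f (regs s (tmp d)) (regs s (tmp d.+1))))) ->
    exists u', [/\ exec inp (Seq (cexpr a d) (Seq (cexpr b d.+1) o)) u
        (ecost a + ecost b).+1 u', represents u' h,
        regs u' (tmp d) = f (ev inp h a) (ev inp h b)
      & forall d', d' < d -> regs u' (tmp d') = regs u (tmp d')].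
  move=> IHa IHb {}d {}u {}h Hu Ho.
  have [u1 [E1 R1 V1 F1]] := IHa d u h Hu.
  have [u2 [E2 R2 V2 F2]] := IHb d.+1 u1 h R1.
  eexists; split.
  - rewrite -[(_ + _).+1]addn1 -addnA; apply: ExecSeq E1 _; apply: ExecSeq E2 _; exact: Ho.
  - exact: represents_tmp.
  - by rewrite /= updateE V2 F2 // V1.
  - move=> d' lt; rewrite /= updateN; last by rewrite /tmp; lia.
    by rewrite F2 ?F1 //; lia.
elim: e d u h => [k|x|a IHa b IHb|a IHa b IHb|a IHa|r a IHa] d u h Hu /=.
- exists (set_reg u (tmp d) k); split.
  + exact: ExecConst.
  + exact: represents_tmp.
  + by rewrite /= updateE.
  + by move=> d' lt; rewrite /= updateN //; rewrite /tmp; lia.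
- have ne : reg x <> tmp d by rewrite /tmp /reg; lia.
  eexists; split.
  + rewrite -[2]/(1 + 1); apply: ExecSeq; [exact: ExecConst | exact: ExecAdd].
  + by do 2 apply: represents_tmp.
  + by case: Hu => Hr _ _; rewrite /= !updateE updateN // Hr addn0.
  + by move=> d' lt; rewrite /= !updateN //; rewrite /tmp; lia.
- by apply: bin => // s; exact: ExecAdd.
- by apply: bin => // s; exact: ExecSub.
- have [u1 [E1 R1 V1 F1]] := IHa d u h Hu.
  eexists; split.
  + rewrite -addn1; apply: ExecSeq E1 _; exact: ExecRead.
  + exact: represents_tmp.
  + by rewrite /= updateE V1.
  + by move=> d' lt; rewrite /= updateN ?F1 //; rewrite /tmp; lia.
- have [u1 [E1 R1 V1 F1]] := IHa d u h Hu.
  have [u2 [E2 R2 V2 F2]] := caddr_correct inp r d R1.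
  eexists; split.
  + rewrite -[6]/(5 + 1); apply: ExecSeq E1 _; apply: ExecSeq E2 _.
    exact: ExecFetch.
  + exact: represents_tmp.
  + by rewrite /= updateE V2 V1; case: R2 => _ -> _.
  + by move=> d' lt; rewrite /= updateN ?F2 ?F1 //; rewrite /tmp; lia.
Qed.

(** One constant [K] serves all subcommands, so that the bounds of consecutive parts add up and a
    loop may iterate any number of times: each tick pays for the at most [K] machine steps attached
    to it. *)
Lemma compile_correct inp c h h' K :
  hexec inp c h h' -> cost c <= K -> forall u, represents u h ->
  exists n u', [/\ exec inp (compile c) u n u', represents u' h'
    & n + K * clock h <= K * clock h'].
Proof.
elim=> {c h h'} [x e h|r a e h|e h|c1 c2 h h1 h2 _ IH1 _ IH2
  |e c1 c2 h h1 nz _ IH|e c1 c2 h h1 z _ IH|e c h h1 h2 nz _ IH1 _ IH2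
  |e c h z] /= leK u Hu.
- have [u1 [E1 [Hr Hm Ho] V1 _]] := cexpr_correct inp e 0 Hu.
  do 2 eexists; split.
  + apply: ExecSeq E1 _; apply: ExecSeq; [exact: ExecConst | exact: ExecAdd].
  + split=> //= y; rewrite (updateN _ _ (_ : tmp 0 <> tmp 1)) // V1 updateE.
    rewrite addn0 {1}/update /reg (inj_eq double_inj) -/(reg y).
    by case: eqP => // _; rewrite updateN ?Hr //; rewrite /reg /tmp; lia.
  + by rewrite mulnS; lia.
- have [u1 [E1 R1 V1 _]] := cexpr_correct inp a 0 Hu.
  have [u2 [E2 R2 V2 _]] := caddr_correct inp r 0 R1.
  have [u3 [E3 [Hr Hm Ho] V3 F3]] := cexpr_correct inp e 1 R2.
  do 2 eexists; split.
  + apply: ExecSeq E1 _; apply: ExecSeq E2 _; apply: ExecSeq E3 _.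
    exact: ExecStore.
  + split=> //= r' b; rewrite V3 F3 // V2 V1 /update.
    (* Region codes are residues modulo 8, so a machine cell determines its region and its index. *)
    have lt8 q : rcode q < 8 by case: q.
    have [/rcode_inj->|ner] := eqVneq (rcode r') (rcode r).
      by rewrite eqn_add2r eqn_pmul2r //; case: eqP.
    case: eqP => [E|_]; last exact: Hm.
    by have := lt8 r; have := lt8 r'; move/eqP: ner; lia.
  + by rewrite mulnS; lia.
- have [u1 [E1 [Hr Hm Ho] V1 _]] := cexpr_correct inp e 0 Hu.
  do 2 eexists; split.
  + by apply: ExecSeq E1 _; exact: ExecWrite.
  + by split=> //=; rewrite V1 Ho.
  + by rewrite mulnS; lia.
- have [|n1 [u1 [E1 R1 T1]]] := IH1 _ _ Hu; first lia.
  have [|n2 [u2 [E2 R2 T2]]] := IH2 _ _ R1; first lia.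
  exists (n1 + n2), u2; split=> //; last lia.
  exact: ExecSeq E1 E2.
- have [u1 [E1 R1 V1 _]] := cexpr_correct inp e 0 Hu.
  have [||n2 [u2 [E2 R2 T2]]] := IH _ u1; [lia|by case: R1|].
  exists (ecost e + n2.+1), u2; split=> //.
  + apply: ExecSeq E1 _; apply: ExecIfT E2; by rewrite V1.
  + by move: T2; rewrite /= mulnS; lia.
- have [u1 [E1 R1 V1 _]] := cexpr_correct inp e 0 Hu.
  have [||n2 [u2 [E2 R2 T2]]] := IH _ u1; [lia|by case: R1|].
  exists (ecost e + n2.+1), u2; split=> //.
  + apply: ExecSeq E1 _; apply: ExecIfF E2; by rewrite V1.
  + by move: T2; rewrite /= mulnS; lia.
- have [u1 [E1 R1 V1 _]] := cexpr_correct inp e 0 Hu.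
  have [||n2 [u2 [E2 R2 T2]]] := IH1 _ u1; [lia|by case: R1|].
  have [n3 [u3 [E3 R3 T3]]] := IH2 leK u2 R2.
  (* The compiled remainder of the loop starts by evaluating [e]; that evaluation becomes the end of
     the current loop body. *)
  inversion E3 as [| | | | | | |? ? ? v ? m1 m2 Ee Ew| | | |]; subst.
  exists (ecost e + (n2 + m1 + m2).+1), u3; split=> //.
  + apply: ExecSeq E1 _; apply: ExecWhileT Ew; first by rewrite V1.
    exact: ExecSeq E2 Ee.
  + by move: T2; rewrite /= mulnS; lia.
- have [u1 [E1 [Hr Hm Ho] V1 _]] := cexpr_correct inp e 0 Hu.
  exists (ecost e + 1), u1; split=> //.
  + by apply: ExecSeq E1 _; apply: ExecWhileF; rewrite V1.
  + by rewrite mulnS; lia.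
Qed.

(** * Simulation of the core *)

(* During the simulation [Ptr] is the length of the output written so far. *)
Fixpoint embed (c : prog) : cmd :=
  match c with
  | Const x k => Assign (CoreReg x) (Cst k)
  | Add x y z => Assign (CoreReg x) (Plus (Var (CoreReg y)) (Var (CoreReg z)))
  | Defs.Sub x y z => Assign (CoreReg x) (Minus (Var (CoreReg y)) (Var (CoreReg z)))
  | Read x y => Assign (CoreReg x) (Inp (Var (CoreReg y)))
  | Fetch x y => Assign (CoreReg x) (At Core (Var (CoreReg y)))
  | Store x y => Put Core (Var (CoreReg x)) (Var (CoreReg y))
  | Write x =>
      Then (Put Out (Var Ptr) (Var (CoreReg x)))
           (Assign Ptr (Plus (Var Ptr) (Cst 1)))
  | Seq c1 c2 => Then (embed c1) (embed c2)
  | If x c1 c2 => Cond (Var (CoreReg x)) (embed c1) (embed c2)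
  | While x c => Loop (Var (CoreReg x)) (embed c)
  end.

Fixpoint reads (O : nat -> nat) (p : nat) (w : seq nat) : Prop :=
  if w is x :: w' then O p = x /\ reads O p.+1 w' else True.

Lemma reads_cat O p u v :
  reads O p (u ++ v) <-> reads O p u /\ reads O (p + size u) v.
Proof.
elim: u p => [|x u IH] p /=; first by rewrite addn0; split=> [|[]].
by rewrite IH addnS addSn; split=> [[? []]|[[]]].
Qed.

Lemma reads_update O p w a v :
  p + size w <= a -> reads O p w -> reads (update O a v) p w.
Proof.
elim: w p => //= x w IH p le [Hx Hw]; split; last by apply: IH => //; lia.
by rewrite updateN //; lia.
Qed.

Lemma reads_rcons O p w v :
  reads O p w -> reads (update O (p + size w) v) p (rcons w v).
Proof.
move=> Hw; rewrite -cats1; apply/reads_cat; split.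
  exact: reads_update.
by split=> //; rewrite updateE.
Qed.

Lemma reads_nth O p w i : reads O p w -> i < size w -> O (p + i) = nth 0 w i.
Proof.
elim: w p i => // x w IH p [|i] /= [Hx Hw] lt; first by rewrite addn0.
by rewrite addnS -addSn IH.
Qed.

(** Besides the simulation proper, this carries what [decide] expects at its start: a blank [Mark]
    region and an empty output tape, the writes of the core having gone to [Out]. *)
Definition simulates (h : hstate) (s : state) : Prop :=
  [/\ forall x, hr h (CoreReg x) = regs s x, hm h Core =1 Defs.mem s,
      reads (hm h Out) 0 (out s), hr h Ptr = size (out s)
    & hm h Mark =1 fun=> 0] /\ ho h = [::].

Lemma simulates_set_reg h s x v :
  simulates h s -> simulates (set_var h (CoreReg x) v) (set_reg s x v).
Proof.
by case=> -[Hr Hm Ho Hp HM] He; split=> //; split=> //= y; rewrite Hr.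
Qed.

(** The factor 2 is due to [Write], which becomes two commands; every other step takes one tick. *)
Lemma embed_correct inp c s n s' :
  exec inp c s n s' -> forall h, simulates h s ->
  exists h', [/\ hexec inp (embed c) h h', simulates h' s'
    & clock h' <= clock h + 2 * n].
Proof.
elim=> {c s n s'} [x k s|x y z s|x y z s|x y s|x y s|x y s|x s
  |c1 c2 s s1 s2 n1 n2 _ IH1 _ IH2|x c1 c2 s s1 n nz _ IH
  |x c1 c2 s s1 n z _ IH|x c s s1 s2 n1 n2 nz _ IH1 _ IH2|x c s z] h Hh /=.
- by eexists; split; [exact: HAssign | exact: simulates_set_reg | rewrite /=; lia].
- have [[Hr _ _ _ _] _] := Hh.
  eexists; split; [exact: HAssign | | rewrite /=; lia].
  by rewrite /= !Hr; exact: simulates_set_reg.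
- have [[Hr _ _ _ _] _] := Hh.
  eexists; split; [exact: HAssign | | rewrite /=; lia].
  by rewrite /= !Hr; exact: simulates_set_reg.
- have [[Hr _ _ _ _] _] := Hh.
  eexists; split; [exact: HAssign | | rewrite /=; lia].
  by rewrite /= !Hr; exact: simulates_set_reg.
- have [[Hr Hm _ _ _] _] := Hh.
  eexists; split; [exact: HAssign | | rewrite /=; lia].
  by rewrite /= !Hr Hm; exact: simulates_set_reg.
- have [[Hr Hm Ho Hp HM] He] := Hh.
  eexists; split; [exact: HPut | | rewrite /=; lia].
  by split=> //; split=> //= a; rewrite !Hr /update; case: eqP.
- have [[Hr Hm Ho Hp HM] He] := Hh.
  eexists; split.
  + by apply: HThen; [exact: HPut | exact: HAssign].
  + split=> //; split=> //=; last by rewrite size_rcons Hp addn1.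
    by rewrite Hr Hp; exact: (@reads_rcons _ 0).
  + by rewrite /=; lia.
- have [h1 [E1 R1 T1]] := IH1 _ Hh; have [h2 [E2 R2 T2]] := IH2 _ R1.
  by exists h2; split; [exact: HThen E1 E2 | | lia].
- have [[Hr _ _ _ _] _] := Hh.
  have [h1 [E1 R1 T1]] := IH (tick h) Hh.
  exists h1; split=> //; last by move: T1; rewrite /=; lia.
  by apply: HCondT E1; rewrite /= Hr.
- have [[Hr _ _ _ _] _] := Hh.
  have [h1 [E1 R1 T1]] := IH (tick h) Hh.
  exists h1; split=> //; last by move: T1; rewrite /=; lia.
  by apply: HCondF E1; rewrite /= Hr.
- have [[Hr _ _ _ _] _] := Hh.
  have [h1 [E1 R1 T1]] := IH1 (tick h) Hh; have [h2 [E2 R2 T2]] := IH2 _ R1.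
  exists h2; split=> //; last by move: T1; rewrite /=; lia.
  by apply: HLoopT E1 E2; rewrite /= Hr.
- have [[Hr _ _ _ _] _] := Hh.
  exists (tick h); split=> //; last by rewrite /=; lia.
  by apply: HLoopF; rewrite /= Hr.
Qed.

(** A step writes at most one symbol. This bounds the data handed to [decide] by the running time of
    the core. *)
Lemma size_out_exec inp c s n s' :
  exec inp c s n s' -> size (out s') <= size (out s) + n.
Proof. by elim=> //= *; rewrite ?size_rcons; lia. Qed.

(** * Weakest preconditions *)

(** Total correctness: termination is part of the claim, and time bounds are postconditions on
    [clock]. *)
Definition wp inp (c : cmd) (Q : hstate -> Prop) (s : hstate) : Prop :=
  exists2 s', hexec inp c s s' & Q s'.

Lemma wp_mono inp c (Q Q' : hstate -> Prop) s :
  wp inp c Q s -> (forall s', Q s' -> Q' s') -> wp inp c Q' s.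
Proof. by case=> s' E q H; exists s' => //; exact: H. Qed.

Lemma wp_assign inp x e (Q : hstate -> Prop) s :
  Q (set_var s x (ev inp s e)) -> wp inp (Assign x e) Q s.
Proof. by move=> q; eexists; [exact: HAssign | ]. Qed.

Lemma wp_put inp r a e (Q : hstate -> Prop) s :
  Q (set_mem s r (ev inp s a) (ev inp s e)) -> wp inp (Put r a e) Q s.
Proof. by move=> q; eexists; [exact: HPut | ]. Qed.

Lemma wp_print inp e (Q : hstate -> Prop) s :
  Q (print s (ev inp s e)) -> wp inp (Print e) Q s.
Proof. by move=> q; eexists; [exact: HPrint | ]. Qed.

Lemma wp_then inp c1 c2 Q s :
  wp inp c1 (wp inp c2 Q) s -> wp inp (Then c1 c2) Q s.
Proof. by case=> s1 E1 [s2 E2 q]; exists s2 => //; exact: HThen E1 E2. Qed.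

Lemma wp_loopT inp e c Q s :
  ev inp s e != 0 -> wp inp c (wp inp (Loop e c) Q) (tick s) ->
  wp inp (Loop e c) Q s.
Proof. by move=> nz [s1 E1 [s2 E2 q]]; exists s2 => //; exact: HLoopT E1 E2. Qed.

Lemma wp_loopF inp e c (Q : hstate -> Prop) s :
  ev inp s e = 0 -> Q (tick s) -> wp inp (Loop e c) Q s.
Proof. by move=> z q; eexists; [exact: HLoopF | ]. Qed.

Ltac wstep := repeat (apply: wp_then); first [apply: wp_assign | apply: wp_put].

Definition agree (xs : seq var) (s s' : hstate) : Prop :=
  forall x, all (fun y => vcode x != vcode y) xs -> hr s' x = hr s x.

(** * The decision procedure *)

Definition incr x := Assign x (Plus (Var x) (Cst 1)).

(** Reads one string. The test is nonzero exactly on the bits 0 and 1, and the last [incr] passes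
    the end mark 2. *)
Definition walk : cmd :=
  Then (Loop (Minus (Cst 2) (At Out (Var Ptr)))
         (Then (Assign Val (Plus (Plus (Var Val) (Var Val)) (At Out (Var Ptr))))
               (incr Ptr)))
       (incr Ptr).

(** [Ptr] enters at the accept section, which precedes the section of node 0; passing an end mark 3
    reaches the section of [Nod]. *)
Definition scan : cmd :=
  Loop (Minus (Inp (Cst 0)) (Var Nod))
    (Then (Loop (Minus (Cst 3) (At Out (Var Ptr))) (incr Ptr))
    (Then (incr Ptr)
    (Then (Put Start (Var Nod) (Var Ptr))
          (incr Nod)))).

(** Node [t] owns the three input cells from [3 * t + 2] on: its number of children and two child
    slots. *)
Definition triple x := Plus (Plus (Var x) (Var x)) (Var x).
Definition nchildren := Inp (Plus (triple Nod) (Cst 2)).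
Definition child := Inp (Plus (Plus (triple Nod) (Cst 3)) (Var Idx)).

Definition push : cmd :=
  Loop (Minus nchildren (Var Idx))
    (Then (Put Queue (Var Tl) child) (Then (incr Tl) (incr Idx))).

Definition bfs : cmd :=
  Loop (Minus (Var Tl) (Var Hd))
    (Then (Assign Nod (At Queue (Var Hd)))
    (Then (incr Hd)
    (Then (Assign Idx (Cst 0))
          push))).

Definition check : cmd :=
  Loop (Minus nchildren (Var Idx))
    (Then (Assign Val (Plus (Inp (Cst 0)) child))
    (Then walk
    (Then (Assign Ok (Minus (Var Ok) (Minus (Cst 1) (At Mark (Var Val)))))
          (incr Idx)))).

(** [Adr] keeps the address of the first entry while [check] reuses [Val]. Adding [Ok] to the old
    mark acts as a disjunction, since only being nonzero matters. *)
Definition tuples : cmd :=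
  Loop (Minus (Cst 3) (At Out (Var Ptr)))
    (Then (Assign Val (Plus (Inp (Cst 0)) (Var Nod)))
    (Then walk
    (Then (Assign Adr (Var Val))
    (Then (Assign Ok (Cst 1))
    (Then (Assign Idx (Cst 0))
    (Then check
          (Put Mark (Var Adr) (Plus (Var Ok) (At Mark (Var Adr)))))))))).

(** [bfs] leaves [Hd] at the end of the queue, so counting down meets children before their
    parents. *)
Definition dp : cmd :=
  Loop (Var Hd)
    (Then (Assign Hd (Minus (Var Hd) (Cst 1)))
    (Then (Assign Nod (At Queue (Var Hd)))
    (Then (Assign Ptr (At Start (Var Nod)))
          tuples))).

Definition accept : cmd :=
  Loop (Minus (Cst 3) (At Out (Var Ptr)))
    (Then (Assign Val (Plus (Inp (Cst 0)) (Inp (Cst 1))))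
    (Then walk
          (Assign Res (Plus (Var Res) (At Mark (Var Val)))))).

(** The double truncated subtraction in the last command turns [Res] into 0 or 1. *)
Definition decide : cmd :=
  Then (Assign Ptr (Cst 0))
  (Then (Assign Nod (Cst 0))
  (Then scan
  (Then (Put Queue (Cst 0) (Inp (Cst 1)))
  (Then (Assign Hd (Cst 0))
  (Then (Assign Tl (Cst 1))
  (Then bfs
  (Then dp
  (Then (Assign Ptr (Cst 0))
  (Then (Assign Res (Cst 0))
  (Then accept
        (Print (Minus (Cst 1) (Minus (Cst 1) (Var Res)))))))))))))).

(** * Reading strings and sections of the core's output *)

Definition push_bits (v : nat) (s : bitstring) : nat :=
  foldl (fun v (b : bool) => v + v + b) v s.

Lemma size_enc_string str : size (enc_string str) = (size str).+1.
Proof. by rewrite size_rcons size_map. Qed.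

Lemma walk_spec inp str s :
  reads (hm s Out) (hr s Ptr) (enc_string str) ->
  wp inp walk (fun s' =>
    [/\ hr s' Ptr = hr s Ptr + size (enc_string str),
        hr s' Val = push_bits (hr s Val) str, agree [:: Ptr; Val] s s',
        hm s' = hm s /\ ho s' = ho s
      & clock s' <= clock s + 3 * size (enc_string str)]) s.
Proof.
move=> R; rewrite size_enc_string; apply: wp_then.
elim: str s R => [|b str IH] s /= [R1 R2].
  apply: wp_loopF; first by rewrite /= R1.
  wstep; split=> //=; last by lia.
  by move=> x /=; case: eqP.
apply: wp_loopT; first by rewrite /= R1; case: (b).
do 2 wstep; apply: wp_mono; first by apply: IH; rewrite /= addn1.
move=> s' H; apply: wp_mono; first exact: H.
move=> {H} s'' /= [-> -> F [-> ->] T]; split=> //.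
- by rewrite /=; lia.
- by rewrite R1.
- by move=> x nx; rewrite F //=; move: nx => /= /and3P[/negbTE-> /negbTE->].
- by move: T; rewrite /=; lia.
Qed.

Definition is_section (w : seq nat) : Prop :=
  exists2 body, all (fun x => x < 3) body & w = rcons body 3.

Lemma skip_spec inp body s :
  all (fun x => x < 3) body ->
  reads (hm s Out) (hr s Ptr) (rcons body 3) ->
  wp inp (Loop (Minus (Cst 3) (At Out (Var Ptr))) (incr Ptr)) (fun s' =>
    [/\ hr s' Ptr = hr s Ptr + size body, hr s' Nod = hr s Nod,
        hm s' = hm s, ho s' = ho s
      & clock s' <= clock s + 2 * size body + 1]) s.
Proof.
elim: body s => [|x body IH] s /= => [_ [R1 _]|/andP[lt3 lts] [R1 R2]].
  by apply: wp_loopF; [rewrite /= R1 | split=> //=; lia].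
apply: wp_loopT; first by rewrite /= R1; lia.
wstep; apply: wp_mono; first by apply: IH => //=; rewrite addn1.
move=> s' /= [-> -> -> -> T]; split=> //; lia.
Qed.

(** For the induction, [w] is the section under [Ptr] and [secs] are the later ones, whose starts
    are still to be recorded. The clause on [j < hr s Nod] protects the starts recorded earlier. *)
Lemma scan_spec inp (secs : seq (seq nat)) (w : seq nat) s :
  hr s Nod + size secs = inp 0 ->
  (forall v, v \in w :: secs -> is_section v) ->
  reads (hm s Out) (hr s Ptr) (w ++ flatten secs) ->
  wp inp scan (fun s' =>
    [/\ forall i, i < size secs ->
          reads (hm s Out) (hm s' Start (hr s Nod + i)) (nth [::] secs i),
        forall j, j < hr s Nod -> hm s' Start j = hm s Start j,
        hm s' Out = hm s Out /\ hm s' Mark = hm s Mark, ho s' = ho s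
      & clock s' <= clock s + 5 * size (w ++ flatten secs) + 1]) s.
Proof.
elim: secs w s => [|w' secs IH] w s /= HN Hsec HR.
  by apply: wp_loopF; [rewrite /= -HN; lia | split=> //=; lia].
apply: wp_loopT; first by rewrite /= -HN; lia.
have [body lt3 def_w] := Hsec w (mem_head _ _).
have /reads_cat[Rw Rs] := HR.
apply: wp_then; apply: wp_mono.
  by apply: (@skip_spec _ body) => //=; rewrite -def_w.
move=> s1 [/= P1 N1 M1 O1 T1].
do 3 wstep; apply: wp_mono.
  apply: (IH w') => /=.
  - by rewrite N1; lia.
  - by move=> v vs; apply: Hsec; rewrite inE vs orbT.
  - by rewrite P1 M1 -addnA addn1 -(size_rcons _ 3) -def_w.
move=> s2 /= [A B [C1 C2] D T]; rewrite N1 M1 O1 in A B C1 C2 D.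
have sz : size w = (size body).+1 by rewrite def_w size_rcons.
split=> //.
- case=> [_|i lt] /=; last by rewrite -addSnnS -addn1; exact: A.
  rewrite addn0 B ?addn1 // updateE P1 -addnS -sz.
  by case/reads_cat: Rs.
- by move=> j lt; rewrite B ?updateN //; lia.
- by move: T T1; rewrite !size_cat sz; lia.
Qed.

(** * Binary addresses of pairs of a node and a string *)

Lemma push_bits_rcons v s b :
  push_bits v (rcons s b) = push_bits v s + push_bits v s + b.
Proof. by rewrite /push_bits foldl_rcons. Qed.

Lemma push_bits_ge v s : v <= push_bits v s.
Proof. by elim/last_ind: s => // s b IH; rewrite push_bits_rcons; lia. Qed.

(* A string of length [k] at node [t] has its address between [N * 2 ^ k] and
   [N * 2 ^ k.+1]. *)
Lemma push_bits_inj N t t' s s' :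
  t < N -> t' < N -> push_bits (N + t) s = push_bits (N + t') s' ->
  t = t' /\ s = s'.
Proof.
move=> lt lt'; elim/last_ind: s s' => [|s b IH] s'; case/lastP: s' => [|s' b'].
- by rewrite /push_bits /= => ?; split=> //; lia.
- by rewrite push_bits_rcons /push_bits /= -/(push_bits _ _);
    have := push_bits_ge (N + t') s'; lia.
- by rewrite push_bits_rcons /push_bits /= -/(push_bits _ _);
    have := push_bits_ge (N + t) s; lia.
- rewrite !push_bits_rcons => E.
  have [|-> ->] := IH s'; first by case: (b) (b') E => [] []; lia.
  by split=> //; congr rcons; case: (b) (b') E => [] []; lia.
Qed.

(** * Encoded tuples and their sections *)

Definition enc_tuple (u : seq bitstring) : seq nat :=
  flatten [seq enc_string s | s <- u].

Lemma enc_tuple_cons s u : enc_tuple (s :: u) = enc_string s ++ enc_tuple u.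
Proof. by []. Qed.

Arguments enc_tuple : simpl never.

Lemma enc_tuples_cons u us :
  enc_tuples (u :: us) = enc_tuple u ++ enc_tuples us.
Proof. by rewrite /enc_tuples /= rcons_cat. Qed.

Lemma enc_string_lt3 s : all (fun x => x < 3) (enc_string s).
Proof. by rewrite all_rcons /= all_map; apply/allP => -[]. Qed.

Lemma enc_tuple_lt3 u : all (fun x => x < 3) (enc_tuple u).
Proof. by elim: u => // s u IH; rewrite all_cat enc_string_lt3. Qed.

Lemma enc_tuples_section us : is_section (enc_tuples us).
Proof.
exists (flatten [seq enc_tuple u | u <- us]) => //.
by elim: us => //= u us IH; rewrite all_cat enc_tuple_lt3.
Qed.

Lemma mem_zip1 (S T : eqType) (s : seq S) (t : seq T) x y :
  (x, y) \in zip s t -> x \in s.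
Proof.
elim: s t => [|a s IH] [|b t] //=; rewrite !inE => /orP[/eqP[-> _]|/IH->].
  by rewrite eqxx.
by rewrite orbT.
Qed.

(** * Correctness of the decision procedure on an abstract rooted tree *)

Section Decide.

Variables (inp : nat -> nat) (N : nat) (root : 'I_N) (ch : 'I_N -> seq 'I_N).
Hypotheses
  (inp_N : inp 0 = N) (inp_root : inp 1 = root)
  (inp_nchildren : forall t : 'I_N, inp (t + t + t + 2) = size (ch t))
  (inp_child : forall (t : 'I_N) i, i < size (ch t) ->
     inp (t + t + t + 3 + i) = nth root (ch t) i).
Hypotheses
  (uniq_ch : forall t, uniq (ch t)) (root_ch : forall t, root \notin ch t)
  (parent_inj : forall t t' c, c \in ch t -> c \in ch t' -> t = t')
  (reach : forall S : pred 'I_N, S root ->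
     (forall t c, S t -> c \in ch t -> S c) -> forall t, S t).

Definition topological (q : seq 'I_N) : Prop :=
  [/\ uniq q, forall t, t \in q
    & forall pre t post, q = pre ++ t :: post -> {subset ch t <= post}].

Lemma push_spec (t : 'I_N) (cs q : seq 'I_N) s :
  hr s Nod = t -> hr s Idx <= size (ch t) -> drop (hr s Idx) (ch t) = cs ->
  reads (hm s Queue) 0 (map val q) -> hr s Tl = size q ->
  wp inp push (fun s' =>
    [/\ reads (hm s' Queue) 0 (map val (q ++ cs)), hr s' Tl = size (q ++ cs),
        hr s' Hd = hr s Hd,
        [/\ hm s' Out = hm s Out, hm s' Start = hm s Start,
            hm s' Mark = hm s Mark & ho s' = ho s]
      & clock s' <= clock s + 4 * size cs + 1]) s.
Proof.
elim: cs q s => [|c cs IH] q s Ht le Hd HQ HT.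
  have /eqP := congr1 size Hd; rewrite size_drop /= => sz.
  apply: wp_loopF; first by rewrite /= Ht inp_nchildren; lia.
  by rewrite cats0; split=> //=; lia.
have := congr1 size Hd; rewrite size_drop /= => sz.
apply: wp_loopT; first by rewrite /= Ht inp_nchildren; lia.
have lt : hr s Idx < size (ch t) by lia.
have Hc : nth root (ch t) (hr s Idx) = c by rewrite -[_ s _]addn0 -nth_drop Hd.
do 3 wstep; apply: wp_mono.
  apply: (IH (rcons q c)) => //=.
  - by lia.
  - by rewrite -[X in drop X]addnC -drop_drop Hd /= drop0.
  - rewrite map_rcons HT Ht inp_child // Hc -(size_map val q).
    exact: (@reads_rcons _ 0).
  - by rewrite size_rcons HT addn1.
by move=> s' /=; rewrite cat_rcons => -[? -> -> [-> -> -> ->] T]; split=> //; lia.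
Qed.

Lemma uniq_size_ord (q : seq 'I_N) : uniq q -> size q <= N.
Proof. by move/card_uniqP <-; rewrite -[X in _ <= X]card_ord max_card. Qed.

(** Freshness comes from the tree: a child of the popped node that were already queued would be the
    root or have a second parent. So the queue stays duplicate-free and has at most [N] entries,
    which bounds both pops and pushes. *)
Lemma bfs_spec (pops pend : seq 'I_N) s :
  uniq (pops ++ pend) -> root \in pops ++ pend ->
  (forall c, c \in pops ++ pend -> c = root \/ exists2 t, t \in pops & c \in ch t) ->
  (forall pre t post, pops = pre ++ t :: post -> {subset ch t <= post ++ pend}) ->
  hr s Hd = size pops -> hr s Tl = size (pops ++ pend) ->
  reads (hm s Queue) 0 (map val (pops ++ pend)) ->
  wp inp bfs (fun s' => exists q,
    [/\ topological q, reads (hm s' Queue) 0 (map val q), hr s' Hd = size q,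
        [/\ hm s' Out = hm s Out, hm s' Start = hm s Start,
            hm s' Mark = hm s Mark & ho s' = ho s]
      & clock s' <= clock s + 5 * (N - size pops)
                    + 4 * (N - size (pops ++ pend)) + 1]) s.
Proof.
have [k] := ubnP (N - size pops).
elim: k pops pend s => // k IH pops [|x pend] s ltk Uq rq par ord HH HT HQ.
  rewrite cats0 in Uq rq par HT HQ.
  apply: wp_loopF; first by rewrite /= HH HT subnn.
  exists pops; split=> //=; last by lia.
  split=> //; last by move=> pre t post /ord; rewrite cats0.
  (* With nothing pending, the popped nodes contain the root and are closed under children. *)
  apply: reach => // t c tq ct; case/splitPr: tq ord {Uq rq par HH HT HQ ltk} => p1 p2 ord.
  by have := ord _ _ _ erefl c ct; rewrite cats0 mem_cat inE => ->; rewrite !orbT.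
have lepp : size (pops ++ x :: pend) <= N by exact: uniq_size_ord.
rewrite size_cat /= in lepp.
apply: wp_loopT; first by rewrite /= HH HT size_cat /=; lia.
have x_fresh : x \notin pops.
  by move: Uq; rewrite cat_uniq /= negb_or => /and3P[_ /andP[]].
have Uq' : uniq ((pops ++ x :: pend) ++ ch x).
  rewrite cat_uniq Uq uniq_ch andbT /=; apply/hasPn => c cx; apply/negP => cq.
  case: (par c cq) => [E|[t tp ct]]; first by move: (root_ch x); rewrite -E cx.
  by move: x_fresh; rewrite (parent_inj cx ct) tp.
have Eq : (pops ++ x :: pend) ++ ch x = rcons pops x ++ (pend ++ ch x).
  by rewrite cat_rcons -catA.
have lepp' := uniq_size_ord Uq'.
do 3 wstep; apply: wp_mono.
  apply: (@push_spec x (ch x) (pops ++ x :: pend)) => //=; rewrite ?drop0 //.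
  rewrite HH; have := reads_nth HQ (i := size pops); rewrite add0n => -> //.
    by rewrite (nth_map root) ?nth_cat ?ltnn ?subnn //= size_cat /=; lia.
  by rewrite size_map size_cat /=; lia.
move=> s1 /= [HQ1 HT1 HH1 [O1 S1 M1 Ho1] T1].
apply: wp_mono.
  apply: (IH (rcons pops x) (pend ++ ch x)).
  - by rewrite size_rcons; lia.
  - by rewrite -Eq.
  - by rewrite -Eq mem_cat rq.
  - move=> c; rewrite -Eq mem_cat => /orP[/par[->|[t tp ct]]|cx]; first by left.
      by right; exists t => //; rewrite mem_rcons inE tp orbT.
    by right; exists x => //; rewrite mem_rcons mem_head.
  - move=> pre t post; case/lastP: post => [|post y].
      rewrite cats1 => /rcons_inj[_ ->] c cx.
      by rewrite !mem_cat cx !orbT.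
    rewrite -rcons_cons -rcons_cat => /rcons_inj[/ord sub <-] c /sub.
    rewrite !(mem_cat, mem_rcons, inE).
    by case/or3P=> ->; rewrite ?orbT.
  - by rewrite HH1 HH size_rcons addn1.
  - by rewrite HT1 Eq.
  - by rewrite -Eq.
move=> s2 [q [Tq HQ2 HH2 [O2 S2 M2 Ho2] T2]]; exists q.
rewrite O2 S2 M2 Ho2; split=> //.
move: T2 T1; rewrite -Eq !size_cat !size_rcons /=; move: lepp'; rewrite !size_cat /=.
lia.
Qed.


(** * Bottom-up computation of the feasible strings *)

Definition marked (s : hstate) (t : 'I_N) (str : bitstring) : bool :=
  hm s Mark (push_bits (N + t) str) != 0.

(** As long as [Ok] is at most 1, truncated subtraction of [1 - Mark] multiplies it by the truth
    value of the mark; the loop thus computes a conjunction. *)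
Lemma check_spec (t : 'I_N) (cs : seq 'I_N) (ss : seq bitstring) s :
  hr s Nod = t -> hr s Idx <= size (ch t) -> drop (hr s Idx) (ch t) = cs ->
  size ss = size cs -> hr s Ok <= 1 ->
  reads (hm s Out) (hr s Ptr) (enc_tuple ss) ->
  wp inp check (fun s' =>
    [/\ hr s' Ptr = hr s Ptr + size (enc_tuple ss),
        hr s' Ok = hr s Ok * all (fun p => marked s p.1 p.2) (zip cs ss),
        agree [:: Ptr; Val; Ok; Idx] s s', hm s' = hm s /\ ho s' = ho s
      & clock s' <= clock s + 7 * size (enc_tuple ss) + 1]) s.
Proof.
elim: cs ss s => [|c cs IH] [|str ss] s //=; rewrite ?enc_tuple_cons => Ht le Hd.
  move=> _ _ _; have /eqP := congr1 size Hd; rewrite size_drop /= => sz.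
  apply: wp_loopF; first by rewrite /= Ht inp_nchildren; lia.
  by split=> //=; lia.
case=> Hsz Hok /reads_cat[R1 R2].
have := congr1 size Hd; rewrite size_drop /= => sz.
apply: wp_loopT; first by rewrite /= Ht inp_nchildren; lia.
have lt : hr s Idx < size (ch t) by lia.
have Hc : nth root (ch t) (hr s Idx) = c by rewrite -[_ s _]addn0 -nth_drop Hd.
wstep; apply: wp_then; apply: wp_mono; first by apply: walk_spec; exact: R1.
move=> s1 /= [P1 V1 F1 [M1 O1] T1].
rewrite Ht inp_N inp_child // Hc in V1.
do 2 wstep; apply: wp_mono.
  apply: (IH ss) => /=; rewrite ?(F1 Nod isT) ?(F1 Idx isT) ?(F1 Ok isT) ?P1 ?M1 //=.
  - by lia.
  - by rewrite -[X in drop X]addnC -drop_drop Hd /= drop0.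
  - by lia.
move=> s2 /= [P2 V2 F2 [M2 O2] T2]; split=> //.
- by rewrite P2 P1 size_cat addnA.
- rewrite V2 (F1 Ok isT) /= /marked V1 /= M1 /=.
  by case: (hm s Mark _) => [|m]; rewrite ?andbF /=; lia.
- by case=> [||||||||| ?] //= _; rewrite F2 //= F1.
- by rewrite M2 O2 /= M1 O1.
- have := size_enc_string str.
  by move: T1 T2; rewrite size_cat; lia.
Qed.

Variable L : 'I_N -> seq (seq bitstring).
Hypothesis size_L : forall t u, u \in L t -> size u = (size (ch t)).+1.

Inductive feasible : 'I_N -> bitstring -> Prop :=
  Feasible t str ss : str :: ss \in L t ->
    (forall p, p \in zip (ch t) ss -> feasible p.1 p.2) -> feasible t str.

(** One derivation step from the current marks. Tuples of [L t] are nonempty, so on them the default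
    of [head] is never met. *)
Definition derives (s : hstate) t (str : bitstring) (u : seq bitstring) : bool :=
  (head [::] u == str)
  && all (fun p => marked s p.1 p.2) (zip (ch t) (behead u)).

(** Marks added during the loop concern [t] only, and [t] is not its own child. Hence every tuple
    may be judged against the marks of the initial state. *)
Lemma tuples_spec (t : 'I_N) (us : seq (seq bitstring)) s :
  t \notin ch t -> {subset us <= L t} -> hr s Nod = t ->
  reads (hm s Out) (hr s Ptr) (enc_tuples us) ->
  wp inp tuples (fun s' =>
    [/\ forall t' str, marked s' t' str =
          marked s t' str || (t' == t) && has (derives s t str) us,
        hr s' Hd = hr s Hd,
        [/\ hm s' Out = hm s Out, hm s' Start = hm s Start,
            hm s' Queue = hm s Queue & ho s' = ho s]
      & clock s' <= clock s + 10 * size (enc_tuples us)]) s.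
Proof.
move=> t_ch; elim: us s => [|u us IH] s sub Ht.
  rewrite /enc_tuples /= => -[R _].
  apply: wp_loopF; first by rewrite /= R.
  split=> //=; last by lia.
  by move=> t' str; rewrite andbF orbF.
rewrite enc_tuples_cons => /reads_cat[].
have := size_L (sub u (mem_head _ _)); case: u sub => // str0 ss sub [sz].
rewrite enc_tuple_cons => /reads_cat[R1 R2] R3.
(* A tuple begins with a bit or with the end mark 2 of an empty string, never with 3. *)
apply: wp_loopT.
  rewrite /=; move: R1; case: (str0) => [|b str1] /= [-> _] //.
  by case: b.
wstep; apply: wp_then; apply: wp_mono; first by apply: walk_spec; exact: R1.
move=> s1 /= [P1 V1 F1 [M1 O1] T1].
rewrite Ht inp_N in V1.
do 3 wstep; apply: wp_then; apply: wp_mono.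
  apply: (@check_spec t (ch t) ss) => //=; rewrite ?(F1 Nod isT) ?drop0 //=.
  by rewrite P1 M1.
move=> s2 /= [P2 V2 F2 [M2 O2] T2].
have A2 := F2 Adr isT; rewrite /= V1 in A2.
wstep; apply: wp_mono.
  apply: IH => /=.
  - by move=> v vs; apply: sub; rewrite inE vs orbT.
  - by rewrite (F2 Nod isT) /= (F1 Nod isT).
  - by rewrite M2 M1 P2 P1 -addnA -size_cat.
rewrite /= (F2 Hd isT) /= (F1 Hd isT) M2 M1 O2 /= O1 A2 V2 mul1n => s3 [K3 H3 Q3 T3].
split=> //; last first.
  have := size_enc_string str0.
  by move: T1 T2 T3; rewrite !size_cat /=; lia.
set sm := set_mem _ _ _ _ in K3.
(* Addresses being injective, the write can only affect the mark of [str0] at [t]. *)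
have mark1 t' str : marked sm t' str =
    marked s t' str || (t' == t) && derives s t str (str0 :: ss).
  rewrite /marked /sm /= /update /derives /=.
  have [->|ne] := eqVneq t' t; last first.
    case: (push_bits _ _ =P push_bits _ _) => [|_]; last by rewrite orbF M2 /= M1.
    case/(push_bits_inj (ltn_ord _) (ltn_ord _)) => /val_inj E.
    by rewrite E eqxx in ne.
  have [E|ne] := eqVneq str0 str.
    rewrite E eqxx /=; set m := hm s Mark _.
    have -> : all (fun p => marked (set_var (set_var (set_var s1 Adr (hr s1 Val)) Ok 1) Idx 0) p.1 p.2)
         (zip (ch t) ss) = all (fun p => marked s p.1 p.2) (zip (ch t) ss).
      by rewrite /marked /= M1.
    by case: (m) (all _ _) => [|?] [].
  case: (push_bits _ _ =P push_bits _ _) => [|_]; last by rewrite orbF M2 /= M1.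
  case/(push_bits_inj (ltn_ord _) (ltn_ord _)) => _ E.
  by rewrite E eqxx in ne.
move=> t' str; rewrite K3 mark1 /= andb_orr orbA.
congr (_ || _ && _); apply: eq_in_has => v _; rewrite /derives.
congr (_ && _); apply: eq_in_all => -[c str'] /= cz.
rewrite mark1; case: eqP => [E|_]; last by rewrite orbF.
by move: t_ch; rewrite -{1}E (mem_zip1 cz).
Qed.

Lemma derives_feasible s (t : 'I_N) str :
  (forall c str', c \in ch t -> marked s c str' <-> feasible c str') ->
  has (derives s t str) (L t) <-> feasible t str.
Proof.
move=> H; split=> [/hasP[u uL]|].
  have := size_L uL; case: u uL => // str0 ss uL _ /andP[/eqP/= <- /allP K].
  apply: Feasible uL _ => -[c str'] cz; apply/H; last exact: (K (c, str')).
  exact: mem_zip1 cz.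
move=> f; case: f H => {}t str' ss uL K H.
apply/hasP; exists (str' :: ss) => //; rewrite /derives /= eqxx /=.
apply/allP => -[c str0] cz; apply/H; last exact: (K (c, str0)).
exact: mem_zip1 cz.
Qed.

(** Invariant: the marks are exactly the feasible pairs at nodes of [post], the part already
    treated. The children of the last node of [pre] all lie in [post], so the strings derivable
    there are the feasible ones. *)
Lemma dp_spec (pre post q : seq 'I_N) s :
  topological q -> q = pre ++ post -> hr s Hd = size pre ->
  reads (hm s Queue) 0 (map val q) ->
  (forall t : 'I_N, reads (hm s Out) (hm s Start t) (enc_tuples (L t))) ->
  (forall t str, marked s t str <-> t \in post /\ feasible t str) ->
  wp inp dp (fun s' =>
    [/\ forall t str, marked s' t str <-> feasible t str,
        hm s' Out = hm s Out /\ ho s' = ho s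
      & clock s' <= clock s + 14 * (\sum_(t <- pre) size (enc_tuples (L t))) + 1]) s.
Proof.
case=> Uq q_all ord; elim/last_ind: pre post s => [|pre t IH] post s.
  move=> Eq HH HQ HO HM.
  apply: wp_loopF; first by rewrite /= HH.
  split=> //=; last by lia.
  move=> t str; rewrite HM; split=> [[]|] //.
  by rewrite -[post]/([::] ++ post) -Eq.
rewrite cat_rcons size_rcons => Eq HH HQ HO HM.
have t_post : t \notin post.
  by move: Uq; rewrite Eq cat_uniq /= => /and3P[_ _ /andP[]].
have sub := ord _ _ _ Eq.
apply: wp_loopT; first by rewrite /= HH.
do 3 wstep; apply: wp_mono.
  apply: (@tuples_spec t (L t)) => //=.
  - by apply: contra t_post => /sub.
  - rewrite HH subn1 /=; have := reads_nth HQ (i := size pre); rewrite add0n => ->.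
      by rewrite (nth_map root) Eq ?nth_cat ?ltnn ?subnn //= size_cat /=; lia.
    by rewrite Eq size_map size_cat /=; lia.
  - have -> // : hm s Queue (hr s Hd - 1) = t.
    rewrite HH subn1 /=; have := reads_nth HQ (i := size pre); rewrite add0n => ->.
      by rewrite (nth_map root) Eq ?nth_cat ?ltnn ?subnn //= size_cat /=; lia.
    by rewrite Eq size_map size_cat /=; lia.
move=> s1 /= [K H1 [O1 S1 Q1 Ho1] T1].
have K1 t' str : marked s1 t' str =
    marked s t' str || (t' == t) && has (derives s t str) (L t) by exact: K.
apply: wp_mono.
  apply: (IH (t :: post)) => //.
  - by rewrite H1 HH subn1.
  - by rewrite Q1.
  - by rewrite O1 S1.
  - move=> t' str; rewrite K1 inE.
    have [->|ne] := eqVneq t' t; last by rewrite /= orbF.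
    have -> : marked s t str = false.
      by case E: (marked s t str) => //; case/(HM t str): E; rewrite (negbTE t_post).
    split=> [/= /derives_feasible f|[_ f]]; last first.
      apply/derives_feasible => // c str' /sub cp.
      by split=> [/HM[]|f'] //; apply/HM.
    split=> //; apply: f => c str' /sub cp.
    by split=> [/HM[]|f'] //; apply/HM.
move=> s2 [K2 [O2 Ho2] T2]; rewrite O2 O1 Ho2 Ho1; split=> //.
rewrite -cats1 big_cat big_seq1 /=.
(* A section has at least its end mark, which absorbs the constant overhead per node. *)
have [body _ E] := enc_tuples_section (L t); move: T1 T2.
by rewrite E size_rcons; lia.
Qed.

Lemma accept_spec (la : seq bitstring) s :
  reads (hm s Out) (hr s Ptr) (enc_tuples [seq [:: str] | str <- la]) ->
  wp inp accept (fun s' =>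
    [/\ (hr s' Res != 0) = (hr s Res != 0) || has (marked s root) la,
        ho s' = ho s
      & clock s' <= clock s +
          6 * size (enc_tuples [seq [:: str] | str <- la])]) s.
Proof.
elim: la s => [|str la IH] s.
  rewrite /enc_tuples /= => -[R _].
  apply: wp_loopF; first by rewrite /= R.
  by split=> //=; rewrite ?orbF //; lia.
rewrite /= enc_tuples_cons enc_tuple_cons cats0 => /reads_cat[R1 R2].
apply: wp_loopT.
  rewrite /=; move: R1; case: (str) => [|b str1] /= [-> _] //.
  by case: b.
wstep; apply: wp_then; apply: wp_mono; first by apply: walk_spec; exact: R1.
move=> s1 /= [P1 V1 F1 [M1 O1] T1].
rewrite inp_root inp_N in V1.
wstep; apply: wp_mono; first by apply: IH; rewrite /= P1 M1.
move=> s2 /= [B2 O2 T2]; split.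
- rewrite B2 (F1 Res isT) V1 M1 /= addn_eq0 negb_and orbA.
  by congr (_ || _); apply: eq_has => str'; rewrite /marked /= M1.
- by rewrite O2 O1.
- have := size_enc_string str; move: T1 T2; rewrite !size_cat /=; lia.
Qed.


(** * Feasible strings and witnesses *)

Lemma witness_feasible (q : seq 'I_N) (a : 'I_N -> bitstring) :
  topological q -> (forall t, a t :: map a (ch t) \in L t) ->
  forall t, feasible t (a t).
Proof.
case=> _ q_all ord Ha.
(* Induction from the end of [q], where the children of a node are met before it. *)
suff H post pre : q = pre ++ post -> forall t, t \in post -> feasible t (a t).
  by move=> t; apply: (H q [::]).
elim: post pre => // x post IH pre Eq t; have {}IH := IH (rcons pre x).
rewrite cat_rcons in IH; rewrite inE => /orP[/eqP->|/(IH Eq)] //.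
apply: Feasible (Ha x) _ => -[c str] cz; have cx := mem_zip1 cz.
have -> : str = a c.
  elim: (ch x) cz {cx} => //= c' cs IHc; rewrite inE.
  by case/orP=> [/eqP[-> ->]|/IHc].
exact/(IH Eq)/(ord _ _ _ Eq).
Qed.

Lemma parentP t : t = root \/ exists x, t \in ch x.
Proof.
pose S t := (t == root) || [exists x, t \in ch x].
have /orP[/eqP|/existsP] : S t; [|by left|by right].
apply: reach => [|x c _ cx]; first by rewrite /S eqxx.
by apply/orP; right; apply/existsP; exists x.
Qed.

(* The strings are chosen from the root downwards, in the order [q]: a node
   receives its string when its parent is treated. *)
Lemma feasible_witness (q : seq 'I_N) str0 :
  topological q -> feasible root str0 ->
  exists a : 'I_N -> bitstring,
    (forall t, a t :: map a (ch t) \in L t) /\ a root = str0.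
Proof.
case=> Uq q_all ord f0.
suff H post pre : q = pre ++ post ->
    (exists a : 'I_N -> bitstring, [/\ a root = str0,
      forall t, t \in pre -> a t :: map a (ch t) \in L t
    & forall t, t = root \/ (exists2 x, x \in pre & t \in ch x) ->
        feasible t (a t)]) ->
    exists a : 'I_N -> bitstring,
      (forall t, t \in q -> a t :: map a (ch t) \in L t) /\ a root = str0.
  have [||a [Ha a_root]] := H q [::] => //.
    by exists (fun=> str0); split=> // t [->|[]].
  by exists a; split=> // t; apply: Ha.
elim: post pre => [|t post IH] pre Eq [a [a_root Ha Hf]].
  by exists a; split=> // t; rewrite Eq cats0; apply: Ha.
apply: (IH (rcons pre t)); first by rewrite cat_rcons.
have [t_pre t_post] : t \notin pre /\ t \notin post.
  by move: Uq; rewrite Eq cat_uniq /= negb_or => /and3P[_ /andP[-> _] /andP[-> _]].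
have sub := ord _ _ _ Eq.
have disj c : c \in post -> c \notin pre.
  move: Uq; rewrite Eq cat_uniq => /and3P[_ /hasPn/(_ c) nc _] cp.
  by apply: nc; rewrite inE cp orbT.
have ft : feasible t (a t).
  (* A parent of [t] precedes [t] in [q], so [t] has already received a feasible string. *)
  apply: Hf; case: (parentP t) => [|[x tx]]; [by left | right; exists x => //].
  have : x \in q by [].
  rewrite Eq mem_cat inE => /or3P[//|/eqP Ex|].
    by move: t_post; rewrite sub // -{2}Ex.
  move=> xp; case/splitPr: xp Eq t_post {IH sub disj} => p1 p2 Eq t_post.
  have := ord (pre ++ t :: p1) x p2; rewrite Eq -catA => /(_ erefl t tx) tp2.
  by move: t_post; rewrite mem_cat inE tp2 !orbT.
have [ss [uL K]] : exists ss, a t :: ss \in L t /\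
    forall p, p \in zip (ch t) ss -> feasible p.1 p.2.
  by case: ft => t1 str ss uL K; exists ss.
have sz : size ss = size (ch t) by have := size_L uL => -[].
(* Only the children of [t] change their string. They lie in [post] and have no other parent, so the
   tuples at the nodes of [pre] are unaffected. *)
pose a' c := if c \in ch t then nth [::] ss (index c (ch t)) else a c.
have a'E : map a' (ch t) = ss.
  apply: (@eq_from_nth _ [::]); rewrite size_map // => i lt.
  rewrite (nth_map t) // /a' mem_nth // index_uniq //.
have a'N c : c \notin ch t -> a' c = a c by rewrite /a' => /negbTE->.
exists a'; split; first by rewrite a'N.
- move=> x; rewrite mem_rcons inE => /orP[/eqP->|xp].
    by rewrite a'E a'N //; apply: contra t_post => /sub.
  rewrite a'N; last by apply/negP => /sub/disj; rewrite xp.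
  have -> : map a' (ch x) = map a (ch x); last exact: Ha.
  apply/eq_in_map => c cx; apply: a'N; apply/negP => ct.
  by move: t_pre; rewrite (parent_inj ct cx) xp.
- move=> x Hx; case: (boolP (x \in ch t)) => xt.
    apply: (K (x, a' x)); rewrite -a'E.
    by elim: (ch t) xt => //= c cs IHc; rewrite !inE => /orP[/eqP->|/IHc->];
      rewrite ?eqxx ?orbT.
  rewrite a'N //; apply: Hf; case: Hx => [|[y]]; first by left.
  rewrite mem_rcons inE => /orP[/eqP->|yp xy]; first by rewrite (negbTE xt).
  by right; exists y.
Qed.

Lemma decide_spec (la : seq bitstring) s :
  let o := enc_tuples [seq [:: str] | str <- la]
           ++ flatten [seq enc_tuples (L t) | t <- enum 'I_N] in
  reads (hm s Out) 0 o -> hm s Mark =1 (fun=> 0) -> ho s = [::] ->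
  wp inp decide (fun s' => exists b : bool,
    [/\ b <-> exists a : 'I_N -> bitstring,
          (forall t, a t :: map a (ch t) \in L t) /\ a root \in la,
        ho s' = [:: nat_of_bool b]
      & clock s' <= clock s + 50 * size o]) s.
Proof.
set acc := enc_tuples [seq _ | _ <- _]; set secs := [seq _ | _ <- _] => o HO HM Ho.
have sz_secs : size secs = N by rewrite size_map size_enum_ord.
have sz_acc : 0 < size acc by rewrite /acc /enc_tuples size_rcons.
have secE (t : 'I_N) : nth [::] secs t = enc_tuples (L t).
  by rewrite (nth_map root) ?size_enum_ord // nth_ord_enum.
have sum_secs : size (flatten secs) = \sum_(t <- enum 'I_N) size (enc_tuples (L t)).
  by rewrite size_flatten /shape -map_comp sumnE big_map.
(* Each section contributes its end mark, so the time of the breadth-first search, linear in [N], is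
   linear in the output length. *)
have leN : N <= size (flatten secs).
  rewrite sum_secs -[X in X <= _]size_enum_ord -sum1_size; apply: leq_sum => t _.
  by rewrite /enc_tuples size_rcons.
do 2 wstep; apply: wp_then; apply: wp_mono.
  apply: (scan_spec (secs := secs) (w := acc)) => //=.
  - by rewrite add0n sz_secs.
  - move=> v; rewrite inE => /orP[/eqP->|/mapP[t _ ->]];
    exact: enc_tuples_section.
move=> s1 /= [HS _ [O1 M1] Ho1 T1].
do 3 wstep; apply: wp_then; apply: wp_mono.
  apply: (@bfs_spec [::] [:: root]) => //=.
  - exact: mem_head.
  - by move=> c; rewrite inE => /eqP; left.
  - by case.
move=> s2 /= [q [Tq HQ HH [O2 S2 M2 Ho2] T2]].
have [Uq q_all _] := Tq.
apply: wp_then; apply: wp_mono.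
  apply: (@dp_spec q [::] q) => //.
  - by rewrite cats0.
  - by move=> t; rewrite O2 S2 O1 -secE; apply: HS; rewrite sz_secs.
  - by move=> t str; rewrite /marked M2 /= M1 HM; split=> [|[]].
move=> s3 /= [K3 [O3 Ho3] T3].
have perm_q : perm_eq q (enum 'I_N).
  by apply: uniq_perm => [||t]; rewrite ?enum_uniq ?q_all ?mem_enum.
rewrite (perm_big _ perm_q) -sum_secs in T3.
do 2 wstep; apply: wp_then; apply: wp_mono.
  apply: (accept_spec (la := la)) => /=; rewrite O3 O2 O1.
  by case/reads_cat: HO.
move=> s4 /= [B4 Ho4 T4].
apply: wp_print; exists (hr s4 Res != 0); split.
- rewrite B4 /=; split=> [/hasP[str strA /K3 f]|[a [Ha aA]]].
    by have [a [Ha a_root]] := feasible_witness Tq f; exists a; rewrite a_root.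
  by apply/hasP; exists (a root) => //; apply/K3; exact: witness_feasible Tq Ha _.
- by rewrite /= Ho4 Ho3 Ho2 Ho1 Ho /=; case: (hr s4 Res) => // n; rewrite subSS sub0n.
- move: T1 T2 T3 T4; rewrite /o -/acc !size_cat /=; lia.
Qed.

End Decide.

(** * Rooted trees *)

Section RootedTree.

Variables (m : nat) (e : rel 'I_m) (q : 'I_m).
Hypothesis tree_e : is_tree e.

Lemma is_childP t s :
  reflect (exists2 p, simple_path e q (rcons p s) s & last q p = t)
          (is_child e q t s).
Proof.
apply: (iffP existsP) => [[n /existsP[p /andP[H /eqP E]]]|[p H E]].
  by exists p.
have [_ Up _] := and3P H.
(* A duplicate-free sequence of vertices has at most [m] members, so the length bound built into
   [is_child] excludes no simple path. *)
have lt : size p < m.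
  have := max_card [in q :: rcons p s]; rewrite (card_uniqP Up) card_ord.
  by rewrite /= size_rcons; lia.
exists (Ordinal lt); apply/existsP; exists (in_tuple p).
by rewrite H E eqxx.
Qed.

Lemma mem_tree_children t s : (s \in tree_children e q t) = is_child e q t s.
Proof. by rewrite mem_filter mem_enum andbT. Qed.

Lemma root_not_child t : q \notin tree_children e q t.
Proof.
rewrite mem_tree_children; apply/is_childP => -[p /and3P[_ + _] _].
by rewrite /= mem_rcons mem_head.
Qed.

(* Two parents of [s] are joined through the root by a path avoiding [s], which
   closes to a cycle at [s]. *)
Lemma tree_parent_inj t t' s :
  s \in tree_children e q t -> s \in tree_children e q t' -> t = t'.
Proof.
rewrite !mem_tree_children; have [sym_e _ _ acyclic] := tree_e.
(* The tree with the vertex [s] removed. *)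
pose e' := [rel x y | [&& e x y, x != s & y != s]].
have sym_e' : symmetric e' by move=> x y; rewrite /= sym_e; do 2 case: (_ != s).
have parent u : is_child e q u s -> [/\ connect e' q u, e u s & u != s].
  case/is_childP => p /and3P[+ + _] <-; rewrite rcons_path => /andP[Hp es].
  rewrite -rcons_cons rcons_uniq => /andP[s_p Up]; split=> //; last first.
    by apply: contraNneq s_p => <-; exact: mem_last.
  apply/connectP; exists p => //.
  elim: p q s_p Hp {es Up} => //= y p IH x.
  rewrite !inE !negb_or => /and3P[xs ys s_p] /andP[exy Hp].
  rewrite exy eq_sym xs eq_sym ys /=; apply: IH => //.
  by rewrite inE negb_or ys.
move=> /parent[ct es ts] /parent[ct' es' ts'].
have : connect e' t t' by apply: connect_trans ct'; rewrite (sym_connect_sym sym_e').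
case/connectP=> p0 /shortenP[p Hp Up _] E; apply/eqP/negPn/negP => ne.
(* As [t] and [t'] differ, [p] is nonempty and the cycle has at least three vertices. *)
apply: (acyclic (s :: t :: p)).
  by case: p Hp Up E => //= _ _ E; rewrite E eqxx in ne.
apply/andP; split; last first.
  rewrite cons_uniq Up andbT inE negb_or eq_sym ts /=.
  elim: p t Hp {Up E ct es ts ne} => //= y p IH x /andP[/and3P[_ _ ys] /IH Hs].
  by rewrite inE negb_or eq_sym ys.
rewrite /= rcons_path sym_e es -E es' andbT /=.
by apply: sub_path Hp => x y /and3P[].
Qed.

(** Prefixes of a simple path from [q] are simple, so consecutive vertices on it are parent and
    child. *)
Lemma tree_reach (S : pred 'I_m) :
  S q -> (forall t c, S t -> c \in tree_children e q t -> S c) ->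
  forall t, S t.
Proof.
move=> Sq Sc t; have [_ _ conn _] := tree_e.
have /connectP[p0 /shortenP[p Hp Up _] ->] := conn q t.
elim/last_ind: p Hp Up => // p x IH; rewrite rcons_path last_rcons => /andP[Hp ex].
move=> Up; apply: (Sc (last q p)).
  by apply: IH => //; move: Up; rewrite -rcons_cons rcons_uniq => /andP[].
rewrite mem_tree_children; apply/is_childP; exists p => //.
by rewrite /simple_path Up rcons_path Hp ex last_rcons eqxx.
Qed.

End RootedTree.

(** * Reading the encoded decomposition *)

Lemma nth_flatten_triples (T : Type) (f : T -> seq nat) (r : seq T) x0 w i j :
  (forall x, size (f x) = 3) -> i < size r -> j < 3 ->
  nth 0 (flatten [seq f x | x <- r] ++ w) (i + i + i + j) = nth 0 (f (nth x0 r i)) j.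
Proof.
move=> sz; elim: r i => [|x r IH] [|i] //= lti ltj.
  by rewrite -catA nth_cat sz ltj.
rewrite -catA nth_cat sz.
have -> : i.+1 + i.+1 + i.+1 + j < 3 = false by lia.
have -> : i.+1 + i.+1 + i.+1 + j - 3 = i + i + i + j by lia.
exact: IH.
Qed.

Section Encoding.

Variables (G : graph) (D : tree_decomposition G).

Lemma encode_child (t : node D) j :
  j < 3 -> nth 0 (encode D) (t + t + t + 2 + j) = nth 0 (enc_children t) j.
Proof.
move=> ltj; rewrite /encode addnAC addn2 /=.
rewrite (nth_flatten_triples t) ?size_enum_ord //.
by rewrite nth_ord_enum.
Qed.

Lemma encode_nchildren (t : node D) :
  nth 0 (encode D) (t + t + t + 2) = size (children t).
Proof. by rewrite -[t + t + t + 2]addn0 encode_child //= size_map. Qed.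

(** The degree bound of the decomposition makes the two child slots sufficient. *)
Lemma encode_nth_child (t : node D) i :
  i < size (children t) ->
  nth 0 (encode D) (t + t + t + 3 + i) = nth (troot D) (children t) i.
Proof.
move=> lti; have le2 : size (children t) <= 2 := td_degree t.
have -> : t + t + t + 3 + i = t + t + t + 2 + i.+1 by lia.
rewrite encode_child; last by lia.
rewrite -(nth_map _ 0 val) //.
by case: i lti => [|[|i]] //; lia.
Qed.

End Encoding.

(** * The simulated core followed by the decision procedure *)

Theorem theorem2 (P : graph_problem) (C : dynamic_core) (HC : solves C P) :
  exists (A : prog) (c : nat),
    forall (G : graph) (D : tree_decomposition G),
      exists (b : bool) (n : nat),
        [/\ b <-> P G,
            runs A (encode D) n [:: nat_of_bool b]
          & n <= c * (\sum_(t : node D) #|` Process C t|%fset + core_time C D)].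
Proof.
pose whole := Then (embed (core_prog C)) decide.
(* Per unit of core time there are 2 ticks for the simulation and 50 for [decide], as the output is
   no longer than that time; [cost whole] converts ticks into machine steps. *)
exists (compile whole), (cost whole * 52) => G D.
have [o [s core_run out_s] [la [lq [la_A lq_Q def_o]]]] := core_spec C D.
have [|h1 [E1 [[_ _ O1 _ M1] Ho1] T1]] :=
  embed_correct core_run (h := HState (fun=> 0) (fun _ => fun=> 0) [::] 0).
  by [].
have szo : size o <= core_time C D by rewrite -out_s (size_out_exec core_run).
rewrite out_s def_o in O1.
pose L (t : node D) := [seq tval u | u <- lq t].
have [|||||||||h2 E2 [b [b_w Ho2 T2]]] :=
  @decide_spec (nth 0 (encode D)) (nnodes D) (troot D) (@children G D)
    _ _ _ _ _ _ _ _ L _ la h1 O1 M1 Ho1.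
all: rewrite //.
- exact: encode_nchildren.
- exact: encode_nth_child.
- by move=> t; rewrite filter_uniq // enum_uniq.
- exact: root_not_child.
- by move=> t t' c; apply: tree_parent_inj; exact: td_tree.
- by apply: tree_reach; exact: td_tree.
- by move=> t u /mapP[v _ ->]; rewrite size_tuple.
have [|n [u [E3 [_ _ Ho3] T3]]] :=
  compile_correct (HThen E1 E2) (leqnn _) (u := init_state); first by [].
(* [L] holds plain sequences and [Process] holds tuples of fixed length; injectivity of [val] passes
   from one to the other. *)
have wit (a : node D -> bitstring) :
    (forall t, a t :: map a (children t) \in L t) /\ a (troot D) \in la <->
    witness C a.
  rewrite /witness la_A; split=> -[Ha aA]; split=> // t.
    have /mapP[v vq E] := Ha t; rewrite -lq_Q.
    by have -> : cons_tuple (a t) (map_tuple a (in_tuple (children t))) = v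
      by exact: val_inj.
  by apply/mapP; eexists; first by rewrite lq_Q; exact: (Ha t).
exists b, n; split.
- by rewrite (HC G D) b_w; split=> -[a /wit]; exists a.
- by exists u => //; rewrite Ho3.
- have T : clock h2 <= 52 * core_time C D.
    by move: T1 T2; rewrite -def_o /=; lia.
  rewrite muln0 addn0 in T3; apply: (leq_trans T3).
  rewrite -mulnA leq_mul2l; apply/orP; right; apply: (leq_trans T).
  by rewrite leq_mul2l leq_addl orbT.
Qed.
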